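(* Let $X$ be a finite simple connected graph with adjacency matrix $A$. Let $u$ be a spectrally extremal vertex and $v$ a vertex with $d(u,v) = \varepsilon_u$. Write $\Phi_u = \{\theta_0,\dots,\theta_{d^*}\}$ with $\theta_r > \theta_{r+1}$ for all $r$, and suppose there are integers $a$, $\Delta$ and $b_0,\dots,b_{d^*}$ with $\theta_r = \frac{a + b_r\sqrt{\Delta}}{2}$ for all $r$. Then $X$ admits perfect state transfer between $u$ and $v$ if and only if the following hold: (i) $u$ and $v$ are antipodal; (ii) there is an integer $\alpha$ such that for every odd $r$, the exponent of $2$ in the prime factorization of $b_0 - b_r$ equals $\alpha$; (iii) for every even $r \ge 2$, the exponent of $2$ in the prime factorization of $b_0 - b_r$ is larger than $\alpha$. If these conditions hold, perfect state transfer between $u$ and $v$ occurs at time $\frac{2\pi}{2^\alpha\sqrt{\Delta}}$ (and at any odd multiple of it).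
   Context: $A = \sum_\theta \theta E_\theta$ is the spectral decomposition of $A$ over its distinct eigenvalues ($E_\theta$ the orthogonal projection onto the $\theta$-eigenspace); $e_w$ is the standard basis vector of $w$. Eigenvalue support $\Phi_u = \{\theta : E_\theta e_u \ne 0\}$; dual degree $d^* = d^*(u) = |\Phi_u|-1$; eccentricity $\varepsilon_u = \max_w d(u,w)$; $u$ is spectrally extremal if $\varepsilon_u = d^*(u)$. $X$ admits perfect state transfer between $u$ and $v$ at time $\tau$ if $|e_v^T \exp(\mathrm{i}\tau A) e_u| = 1$. Vertices $u,v$ are cospectral if $X\setminus u$ and $X\setminus v$ have the same adjacency spectrum. Let $\varphi$ be the positive eigenvector of $A$ for its largest eigenvalue and $D = \mathrm{diag}(\varphi)$. A partition of $V(X)$ is pseudo equitable if for each class $C$ and vertex $x$, $\sum_{y\in C}(D^{-1}AD)_{x,y}$ depends only on the class containing $x$. The distance partition of $u$ is the partition into the sets $\{w : d(u,w)=i\}$. Vertices $u$ and $v$ are antipodal if: there is a pseudo equitable partition that is simultaneously the distance partition of $u$ and of $v$; $\{u\}$ and $\{v\}$ are singleton classes of this partition at maximum distance from each other; and $u$ and $v$ are cospectral. *)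

(* Defs.v *)
From HB Require Import structures.
From mathcomp Require Import all_boot all_order all_algebra.
From mathcomp Require Import all_classical all_reals all_analysis.
Set Implicit Arguments. Unset Strict Implicit. Unset Printing Implicit Defensive.
Import Order.TTheory GRing.Theory Num.Theory numFieldNormedType.Exports.
Local Open Scope ring_scope.

Section Defs.
Variable n : nat.
Implicit Types (adj : rel 'I_n).

Definition simple_graph adj : Prop := symmetric adj /\ irreflexive adj.

Definition connected_graph adj : Prop := forall x y, connect adj x y.

Definition walk_len adj (k : nat) (x y : 'I_n) : bool :=
  [exists p : k.-tuple 'I_n, path adj x p && (last x p == y)].

(* graph distance: least k with a walk of length k (in a connected graph it is < n);
   (the value n is returned if y is unreachable, which never happens here) *)
Definition gdist adj (x y : 'I_n) : nat :=
  find (fun k => walk_len adj k x y) (iota 0 n).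

Definition ecc adj (u : 'I_n) : nat := \max_(w : 'I_n) gdist adj u w.

Definition distpart adj (u : 'I_n) : {set {set 'I_n}} :=
  [set [set w | gdist adj u w == gdist adj u x] | x : 'I_n].

Variable R : realType.

Definition adjmx adj : 'M[R]_n := \matrix_(i, j) (adj i j)%:R.

Definition evec (w : 'I_n) : 'cV[R]_n := delta_mx w 0.

(* orthogonal projection onto the theta-eigenspace of A:
   with B a basis (rows) of the eigenspace, E = B^T (B B^T)^-1 B.
   (E = 0 if theta is not an eigenvalue.) *)
Definition eproj (A : 'M[R]_n) (theta : R) : 'M[R]_n :=
  let B := row_base (eigenspace A theta) in
  B^T *m invmx (B *m B^T) *m B.

(* Entries of exp(i tau A) via the exponential power series:
   Re = sum_k (-1)^k tau^(2k) A^(2k) / (2k)!,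
   Im = sum_k (-1)^k tau^(2k+1) A^(2k+1) / (2k+1)! . *)
Definition expiA_re (A : 'M[R]_n) (tau : R) (x y : 'I_n) : R :=
  limn (series (fun k : nat =>
    (-1) ^+ k * tau ^+ (2 * k) / ((2 * k)`!)%:R * (A ^+ (2 * k)) x y)).
Definition expiA_im (A : 'M[R]_n) (tau : R) (x y : 'I_n) : R :=
  limn (series (fun k : nat =>
    (-1) ^+ k * tau ^+ (2 * k).+1 / ((2 * k).+1`!)%:R * (A ^+ (2 * k).+1) x y)).

Definition pst_at adj (u v : 'I_n) (tau : R) : Prop :=
  let A := adjmx adj in
  expiA_re A tau v u ^+ 2 + expiA_im A tau v u ^+ 2 = 1.

Definition pst adj (u v : 'I_n) : Prop := exists tau : R, pst_at adj u v tau.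

Definition cospectral adj (u v : 'I_n) : Prop :=
  char_poly (row' u (col' u (adjmx adj))) = char_poly (row' v (col' v (adjmx adj))).

Definition perron_vec (A : 'M[R]_n) (phi : 'cV[R]_n) : Prop :=
  (forall i, 0 < phi i 0) /\
  exists rho : R, [/\ A *m phi = rho *: phi, eigenvalue A rho &
                      forall theta, eigenvalue A theta -> theta <= rho].

Definition pseudo_equitable (A : 'M[R]_n) (phi : 'cV[R]_n) (P : {set {set 'I_n}}) : Prop :=
  let D := diag_mx phi^T in
  let M := invmx D *m A *m D in
  forall C K, C \in P -> K \in P -> forall x y, x \in K -> y \in K ->
    \sum_(z in C) M x z = \sum_(z in C) M y z.

Definition antipodal adj (u v : 'I_n) : Prop :=
  [/\ exists phi, perron_vec (adjmx adj) phi /\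
                  pseudo_equitable (adjmx adj) phi (distpart adj u),
      distpart adj u = distpart adj v,
      [set w | gdist adj u w == gdist adj u v] = [set v],
      gdist adj u v = ecc adj u &
      cospectral adj u v].

End Defs.

(* Main.v *)
(* Perfect state transfer at time [tau] says that [exp (i tau A) e_u] is a unit multiple of
   [e_v]. By the equality case of Cauchy-Schwarz it means that [E_r e_v = s_r E_r e_u] with
   signs [s_r] such that [s_r s_0 = cos (tau (theta_0 - theta_r))] for every [theta_r] in
   the eigenvalue support of [u]. Since [d(u, v) = d*], the weights [s_r |E_r e_u|^2] on the
   [d* + 1] nodes [theta_r] annihilate all polynomials of degree less than [d*], so the
   signs alternate, and the phase conditions become the conditions on 2-adic valuations.
   Given such signs, the walk modules of [u] and [v] coincide and have dimension [d* + 1];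
   comparing Krylov spaces of [u] and [v] of complementary dimensions shows that this
   module is spanned by vectors supported on the distance classes, which makes the
   distance partition pseudo equitable. Conversely, if [u] and [v] are antipodal, the walk
   module of [u] is spanned by the restrictions of the Perron vector to the distance
   classes, so it contains [e_v], and cospectrality forces [E_r e_v = s_r E_r e_u] with
   [s_r = 1] or [s_r = -1]. *)
Require Import Defs.
From HB Require Import structures.
From mathcomp Require Import all_boot all_order all_algebra.
From mathcomp Require Import all_classical all_reals all_analysis.
From mathcomp Require Import complex ring lra zify.
Import Order.TTheory GRing.Theory Num.Theory numFieldNormedType.Exports.
Local Open Scope ring_scope.
Set Implicit Arguments. Unset Strict Implicit. Unset Printing Implicit Defensive.

(** * Spectral projections of real symmetric matrices *)

Section Spectral.
Variable R : realType.

Lemma row_dot_self_eq0 n (w : 'rV[R]_n) : (w *m w^T) 0 0 <= 0 -> w = 0.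
Proof.
rewrite mxE => h; apply/rowP => j; rewrite mxE; apply/eqP.
have sq i : w 0 i * w^T i 0 = w 0 i ^+ 2 by rewrite mxE expr2.
have h0 : \sum_i w 0 i * w^T i 0 == 0.
  by rewrite eq_le h sumr_ge0 // => i _; rewrite sq sqr_ge0.
rewrite psumr_eq0 in h0; last by move=> i _; rewrite sq sqr_ge0.
by move/allP: h0 => /(_ j); rewrite mem_index_enum sq sqrf_eq0 => /(_ isT).
Qed.

(** If [v B B^T = 0] then [|v B|^2 = 0]. Hence the [invmx] in [eproj] is a genuine inverse. *)
Lemma gram_unitmx m n (B : 'M[R]_(m, n)) : row_free B -> B *m B^T \in unitmx.
Proof.
move=> Bfree; rewrite -row_free_unit; apply: inj_row_free => v.
rewrite mulmxA => h.
have : v *m B = 0.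
  apply: row_dot_self_eq0.
  by rewrite trmx_mul mulmxA h mul0mx mxE.
by move/eqP; rewrite mulmx_free_eq0 // => /eqP.
Qed.

(** Over the complex numbers the matrix is Hermitian and its spectral diagonal is real, so a product
    of distinct real factors [X - x] annihilates it; the minimal polynomial over the reals divides
    this product. *)
Lemma symmetric_diagonalizable n (A : 'M[R]_n.+1) : A^T = A -> diagonalizable A.
Proof.
move=> Asym; pose f := real_complex R; pose AC := map_mx f A.
have herm : AC \is hermsymmx.
  apply: realsym_hermsym.
    apply/is_hermitianmxP; rewrite expr0 scale1r.
    by apply/matrixP => i j; rewrite !mxE -[in LHS]Asym mxE.
  by apply/mxOverP => i j; rewrite mxE complex_real.
have /orthomx_spectralP ACE := hermitian_normalmx herm.
have /mxOverP spreal := hermitian_spectral_diag_real herm.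
pose d := map_mx (@complex.Re R) (spectral_diag AC).
have dE : map_mx f d = spectral_diag AC.
  by apply/rowP => j; rewrite !mxE; apply/RRe_real/spreal.
apply/diagonalizableP; pose rs := undup [seq d 0 i | i <- enum 'I_n.+1].
exists rs; first exact: undup_uniq.
rewrite dvd_mxminpoly -(inj_eq (map_mx_inj (f := f))) map_mx0 map_horner_mx.
rewrite -/AC ACE -dE horner_mx_uconjC ?spectral_unit //.
rewrite horner_mx_diag.
suff -> : map_mx (horner (map_poly f (\prod_(x <- rs) ('X - x%:P)))) (map_mx f d) = 0.
  by rewrite linear0 mulmx0 mul0mx.
apply/rowP => j; rewrite [LHS]mxE [map_mx f d _ _]mxE horner_map [RHS]mxE.
suff /rootP -> : root (\prod_(x <- rs) ('X - x%:P)) (d 0 j) by rewrite rmorph0.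
rewrite root_prod_XsubC mem_undup.
by apply/mapP; exists j; rewrite ?mem_enum.
Qed.

Section Eproj.
Variables (n : nat) (A : 'M[R]_n.+1).
Hypothesis Asym : A^T = A.
Local Notation E := (eproj A).

Lemma eproj_tr theta : (E theta)^T = E theta.
Proof.
rewrite /eproj; move: (row_base _) => B.
by rewrite trmx_mul [(_ *m invmx _)^T]trmx_mul trmxK trmx_inv trmx_mul trmxK mulmxA.
Qed.

Lemma eproj_sub theta : (E theta <= eigenspace A theta)%MS.
Proof. by rewrite /eproj (submx_trans (submxMl _ _)) ?eq_row_base. Qed.

Lemma mul_eproj theta : E theta *m A = theta *: E theta.
Proof. exact/eigenspaceP/eproj_sub. Qed.

Lemma eproj_mul theta : A *m E theta = theta *: E theta.
Proof. by apply: trmx_inj; rewrite trmx_mul linearZ /= eproj_tr Asym mul_eproj. Qed.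

Lemma eproj_fix theta m (v : 'M[R]_(m, n.+1)) :
  v *m A = theta *: v -> v *m E theta = v.
Proof.
move=> /eigenspaceP; rewrite -(eq_row_base (eigenspace A theta)).
rewrite /eproj; move: (row_base _) (row_base_free (eigenspace A theta)) => B Bfree.
by case/submxP => w ->; rewrite !mulmxA -[w *m _ *m _]mulmxA mulmxK // gram_unitmx.
Qed.

Lemma eproj_idem theta : E theta *m E theta = E theta.
Proof. exact/eproj_fix/mul_eproj. Qed.

Lemma eproj_ortho theta mu : theta != mu -> E theta *m E mu = 0.
Proof.
move=> ne; have : (theta - mu) *: (E theta *m E mu) = 0.
  rewrite scalerBl scalemxAl -mul_eproj -mulmxA eproj_mul -scalemxAr.
  by rewrite subrr.
by move/eqP; rewrite scaler_eq0 subr_eq0 (negPf ne) => /eqP.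
Qed.

Lemma eproj_notin (rs : seq R) theta : \sum_(r <- rs) E r = 1%:M ->
  theta \notin rs -> E theta = 0.
Proof.
move=> rsE theta_rs; rewrite -[LHS]mulmx1 -rsE mulmx_sumr big_seq big1 // => r rrs.
by rewrite eproj_ortho //; apply: contraNneq theta_rs => ->.
Qed.

(** Diagonalizability writes [1] as a sum of terms [w i *m eigenspace A r_i]; right multiplication
    by one projection fixes its own term and kills the others. *)
Lemma eproj_sum_eq1 : exists2 rs : seq R, uniq rs & \sum_(r <- rs) E r = 1%:M.
Proof.
have /diagonalizablePeigen[rs rs_uniq rsE] := symmetric_diagonalizable Asym.
exists rs => //.
have [w] : exists w : 'I_(size rs) -> 'M[R]_n.+1,
    1%:M = \sum_i w i *m eigenspace A (nth 0 rs i).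
  apply/sub_sumsmxP; move: rsE; rewrite (big_nth 0) big_mkord => rsE.
  by rewrite rsE.
move=> oneE; rewrite (big_nth 0) big_mkord.
have fixE r : eigenspace A r *m E r = eigenspace A r by exact/eproj_fix/eigenspaceP.
rewrite -[LHS]mul1mx oneE mulmx_suml; apply: eq_bigr => i _.
rewrite mulmx_sumr (bigD1 i) //= -mulmxA fixE big1 ?addr0 // => j ji.
by rewrite -mulmxA -fixE -mulmxA eproj_ortho ?mulmx0 // nth_uniq // eq_sym.
Qed.
End Eproj.
End Spectral.

(** * Powers of a symmetric matrix in terms of its spectral projections *)

Section Powers.
Variables (R : realType) (n : nat) (A : 'M[R]_n.+1).
Hypothesis Asym : A^T = A.
Local Notation E := (eproj A).

Lemma exp_mul_eproj k theta : A ^+ k *m E theta = theta ^+ k *: E theta.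
Proof.
elim: k => [|k IHk]; first by rewrite expr0 mul1mx scale1r.
by rewrite exprSr -[_ * A]/(_ *m A) -mulmxA eproj_mul // -scalemxAr IHk scalerA -exprS.
Qed.

Lemma exp_tr k : (A ^+ k)^T = A ^+ k.
Proof.
elim: k => [|k IHk]; first by rewrite expr0 trmx1.
by rewrite [in LHS]exprS -[A * _]/(A *m _) trmx_mul IHk Asym exprSr.
Qed.

Lemma eproj_normE theta x : (row x (E theta) *m (row x (E theta))^T) 0 0 = E theta x x.
Proof.
by rewrite tr_row eproj_tr -[in RHS](eproj_idem A) !mxE; apply: eq_bigr => j _; rewrite !mxE.
Qed.

Lemma eproj_diag_ge0 theta x : 0 <= E theta x x.
Proof.
rewrite -eproj_normE mxE sumr_ge0 // => j _.
by rewrite [X in _ * X]mxE -expr2 sqr_ge0.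
Qed.

Lemma eproj_diag_gt0 theta x : row x (E theta) != 0 -> 0 < E theta x x.
Proof.
move=> h; rewrite lt_neqAle eproj_diag_ge0 andbT eq_sym; apply: contra h => /eqP h.
by apply/eqP/row_dot_self_eq0; rewrite eproj_normE h.
Qed.

Lemma row_eproj_evec theta x : (row x (E theta) == 0) = (E theta *m evec R x == 0).
Proof. by rewrite -(inj_eq trmx_inj) tr_row trmx0 eproj_tr colE. Qed.

Lemma expmx_decomp (rs : seq R) k : \sum_(r <- rs) E r = 1%:M ->
  A ^+ k = \sum_(r <- rs) r ^+ k *: E r.
Proof.
move=> rsE; rewrite -[LHS]mulmx1 -rsE mulmx_sumr.
by apply: eq_bigr => r _; rewrite exp_mul_eproj.
Qed.
End Powers.

(** * Graph distance and powers of the adjacency matrix *)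

Section Distance.
Variables (R : realType) (n : nat) (adj : rel 'I_n.+1).
Hypothesis adj_sym : symmetric adj.
Local Notation A := (adjmx R adj).

Lemma adjmx_tr : A^T = A.
Proof. by apply/matrixP => i j; rewrite !mxE adj_sym. Qed.

Lemma walk_lenS k x y :
  walk_len adj k.+1 x y = [exists z, adj x z && walk_len adj k z y].
Proof.
apply/existsP/existsP => [[p]|[z /andP[xz /existsP[p /andP[pP lP]]]]].
  case/tupleP: p => z p /= /andP[/andP[xz zp] lst].
  by exists z; rewrite xz; apply/existsP; exists p; rewrite zp.
by exists [tuple of z :: p]; rewrite /= xz pP.
Qed.

Lemma adjmx_exp_ge0 k x y : 0 <= (A ^+ k) x y.
Proof.
elim: k x y => [|k IHk] x y; first by rewrite expr0 mxE; case: eqP.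
rewrite exprS -[A * _]/(A *m _) mxE sumr_ge0 // => z _.
by rewrite mulr_ge0 // mxE.
Qed.

Lemma walk_lenE k x y : walk_len adj k x y = ((A ^+ k) x y != 0).
Proof.
elim: k x y => [|k IHk] x y.
  rewrite expr0 mxE; apply/existsP/idP => [[p]|].
    by rewrite tuple0 /= => ->; rewrite oner_eq0.
  by case: (x == y) /eqP => [<- _|]; [exists [tuple] => /= | rewrite eqxx].
rewrite walk_lenS exprS -[A * _]/(A *m _) mxE psumr_neq0; last first.
  by move=> z _; rewrite mulr_ge0 ?adjmx_exp_ge0 // mxE.
apply/existsP/hasP => [[z]|[z _]].
  rewrite IHk => /andP[xz zy]; exists z; rewrite ?mem_index_enum //=.
  by rewrite mxE xz mul1r lt_neqAle eq_sym zy adjmx_exp_ge0.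
rewrite mxE /=; case xz: (adj x z); last by rewrite mul0r ltxx.
by rewrite mul1r => /gt_eqF zy; exists z; rewrite xz IHk zy.
Qed.

Lemma gdist_le_walk k x y : walk_len adj k x y -> (gdist adj x y <= k)%N.
Proof.
move=> w; rewrite /gdist leqNgt; apply/negP => lt.
(* [find] never exceeds the length of the searched list, so [k] is one of its positions. *)
have kn : (k < n.+1)%N.
  by rewrite (leq_trans lt) // -[leqRHS](size_iota 0) find_size.
by have := before_find 0%N lt; rewrite nth_iota // add0n w.
Qed.

Lemma exp_eq0_gdist k x y : (k < gdist adj x y)%N -> (A ^+ k) x y = 0.
Proof.
move=> lt; apply/eqP; apply: contraTT lt; rewrite -walk_lenE -leqNgt.
exact: gdist_le_walk.
Qed.

Lemma gdistxx x : gdist adj x x = 0%N.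
Proof.
by apply/eqP; rewrite -leqn0 gdist_le_walk // walk_lenE expr0 mxE eqxx oner_eq0.
Qed.

Hypothesis adj_conn : connected_graph adj.

(** Shortening a path to one without repeated vertices leaves fewer than [n.+1] edges, so the search
    range of [gdist] is long enough. *)
Lemma walk_gdist x y : walk_len adj (gdist adj x y) x y.
Proof.
have /connectP[p0 p0P ->] := adj_conn x y.
case: (shortenP p0P) => p pP p_uniq _.
have szp : (size p < n.+1)%N.
  by have := max_card [in x :: p]; rewrite (card_uniqP p_uniq) card_ord.
have h : has (fun k => walk_len adj k x (last x p)) (iota 0 n.+1).
  apply/hasP; exists (size p); first by rewrite mem_iota.
  by apply/existsP; exists (in_tuple p); rewrite /= pP eqxx.
have := nth_find 0%N h; rewrite nth_iota ?add0n //.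
by move: h; rewrite has_find size_iota.
Qed.

Lemma exp_gdist_neq0 x y : (A ^+ gdist adj x y) x y != 0.
Proof. by rewrite -walk_lenE walk_gdist. Qed.

Lemma gdistC x y : gdist adj x y = gdist adj y x.
Proof.
wlog suff : x y / (gdist adj x y <= gdist adj y x)%N.
  by move=> h; apply/eqP; rewrite eqn_leq !h.
apply: gdist_le_walk; rewrite walk_lenE.
by rewrite -(exp_tr adjmx_tr) mxE exp_gdist_neq0.
Qed.

Lemma gdist_triangle z x y : (gdist adj x y <= gdist adj x z + gdist adj z y)%N.
Proof.
apply: gdist_le_walk; rewrite walk_lenE exprD -[_ * _]/(_ *m _) mxE psumr_neq0.
  apply/hasP; exists z; rewrite ?mem_index_enum //=.
  by rewrite lt_neqAle eq_sym mulf_neq0 ?exp_gdist_neq0 // mulr_ge0 ?adjmx_exp_ge0.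
by move=> t _; rewrite mulr_ge0 ?adjmx_exp_ge0.
Qed.

Lemma gdist_eq0 x y : gdist adj x y = 0%N -> x = y.
Proof.
move=> h; have := walk_gdist x y; rewrite h walk_lenE expr0 mxE.
by case: (x =P y) => // _ /=; rewrite mulr0n eqxx.
Qed.

Lemma gdist_le_ecc x y : (gdist adj x y <= ecc adj x)%N.
Proof. exact: (leq_bigmax y). Qed.
End Distance.

(** * The exponential of the adjacency matrix *)

Section Trigo.
Variable R : realType.
Implicit Types (x : R) (k : int).

Lemma cosDzpi x k : cos (x + k%:~R * pi) = (-1) ^+ odd `|k| * cos x.
Proof.
have natE (y : R) m : cos (y + m%:R * pi) = (-1) ^+ odd m * cos y.
  by rewrite mulr_natl (alternatingn (@cosDpi R)) signr_odd.
case: k => m; first exact: natE.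
rewrite NegzE abszN absz_nat mulrNz mulNr.
by rewrite -[x in RHS](subrK (m.+1%:R * pi)) natE mulrA -signr_addb addbb mul1r.
Qed.

Lemma sinDzpi x k : sin (x + k%:~R * pi) = (-1) ^+ odd `|k| * sin x.
Proof.
have natE (y : R) m : sin (y + m%:R * pi) = (-1) ^+ odd m * sin y.
  by rewrite mulr_natl (alternatingn (@sinDpi R)) signr_odd.
case: k => m; first exact: natE.
rewrite NegzE abszN absz_nat mulrNz mulNr.
by rewrite -[x in RHS](subrK (m.+1%:R * pi)) natE mulrA -signr_addb addbb mul1r.
Qed.

(** With [k] the floor of [x / pi], the remainder [x - k pi] lies in [[0, pi)], and [sin] is
    positive in the interior. *)
Lemma sin_eq0_zpi x : sin x = 0 -> exists k, x = k%:~R * pi.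
Proof.
move=> sx; exists (Num.floor (x / pi)); set k := Num.floor _.
have pi0 := pi_gt0 R.
have := floor_itv (x / pi); rewrite -/k => /andP[].
rewrite ler_pdivlMr // ltr_pdivrMr // intrD mulrDl mul1r => kx xk.
apply/eqP; rewrite eq_le kx andbT leNgt -subr_gt0; apply/negP => y0.
have : 0 < sin (x - k%:~R * pi) by rewrite sin_gt0_pi // y0 ltrBlDl.
by rewrite -mulNr -mulrNz sinDzpi sx mulr0 ltxx.
Qed.

Lemma cos_sign_zpi x (b : bool) : cos x = (-1) ^+ b ->
  exists2 k, x = k%:~R * pi & odd `|k| = b.
Proof.
move=> cx; have [|k xk] := @sin_eq0_zpi x.
  by apply: cos1sin0; rewrite cx normrX normrN1 expr1n.
exists k => //; move: cx.
by rewrite xk -[_ * pi]add0r cosDzpi cos0 mulr1 => /signr_inj.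
Qed.
End Trigo.

(** * Entries of the exponential as spectral sums *)

Section Exponential.
Variables (R : realType) (n : nat) (A : 'M[R]_n.+1).
Hypothesis Asym : A^T = A.
Local Notation E := (eproj A).
Variable rs : seq R.
Hypothesis rsE : \sum_(r <- rs) E r = 1%:M.
Local Open Scope classical_set_scope.

Lemma cvg_series_sum (c : R -> R) (f : R -> nat -> R) (l : R -> R) (s : seq R) :
  (forall r, series (f r) @ \oo --> l r) ->
  series (fun k => \sum_(r <- s) c r * f r k) @ \oo --> \sum_(r <- s) c r * l r.
Proof.
move=> fl; have -> : series (fun k => \sum_(r <- s) c r * f r k) =
    (fun m => \sum_(r <- s) c r * series (f r) m).
  apply/funext => m; rewrite /series /= exchange_big /=.
  by apply: eq_bigr => r _; rewrite mulr_sumr.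
elim: s => [|r s IHs].
  by rewrite big_nil; under eq_fun do rewrite big_nil; exact: cvg_cst.
rewrite big_cons; under eq_fun do rewrite big_cons.
by apply: cvgD IHs; apply: cvgMr; exact: fl.
Qed.

Lemma expiA_reE tau x y :
  expiA_re A tau x y = \sum_(r <- rs) E r x y * cos (tau * r).
Proof.
apply/cvg_lim => //.
suff -> : (fun k : nat => (-1) ^+ k * tau ^+ (2 * k) / ((2 * k)`!)%:R * (A ^+ (2 * k)) x y) =
    (fun k => \sum_(r <- rs) E r x y * cos_coeff' (tau * r) k).
  by apply: cvg_series_sum => r; apply: cvg_cos_coeff'.
apply/funext => k.
rewrite (expmx_decomp Asym _ rsE) summxE mulr_sumr; apply: eq_bigr => r _.
rewrite mxE /cos_coeff' -mul2n exprMn -exprnP; ring.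
Qed.

Lemma expiA_imE tau x y :
  expiA_im A tau x y = \sum_(r <- rs) E r x y * sin (tau * r).
Proof.
apply/cvg_lim => //.
suff -> : (fun k : nat =>
    (-1) ^+ k * tau ^+ (2 * k).+1 / ((2 * k).+1`!)%:R * (A ^+ (2 * k).+1) x y) =
    (fun k => \sum_(r <- rs) E r x y * sin_coeff' (tau * r) k).
  by apply: cvg_series_sum => r; apply: cvg_sin_coeff'.
apply/funext => k.
rewrite (expmx_decomp Asym _ rsE) summxE mulr_sumr; apply: eq_bigr => r _.
rewrite mxE /sin_coeff' -mul2n exprMn -exprnP; ring.
Qed.
End Exponential.

(** * Transfer amplitudes of modulus one *)

Section Transfer.
Variables (R : realType) (n : nat) (A : 'M[R]_n.+1).
Hypothesis Asym : A^T = A.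
Local Notation E := (eproj A).
Variable rs : seq R.
Hypotheses (rs_uniq : uniq rs) (rsE : \sum_(r <- rs) E r = 1%:M).

Lemma sum_scale_eproj (f : R -> R) t : t \in rs ->
  (\sum_(r <- rs) f r *: E r) *m E t = f t *: E t.
Proof.
move=> trs; rewrite mulmx_suml (bigD1_seq t) //= -scalemxAl eproj_idem.
rewrite big1 ?addr0 // => r rt.
by rewrite -scalemxAl eproj_ortho ?scaler0.
Qed.

Lemma sum_scale_eproj_sqr (f : R -> R) :
  (\sum_(r <- rs) f r *: E r) *m (\sum_(r <- rs) f r *: E r) =
  \sum_(r <- rs) f r ^+ 2 *: E r.
Proof.
rewrite mulmx_sumr big_seq [RHS]big_seq; apply: eq_bigr => r rrs.
by rewrite -scalemxAr sum_scale_eproj // scalerA expr2.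
Qed.

(* Cauchy-Schwarz equality case: the unit vector [e_v] has inner product 1 with
   the vector [\sum f r E_r e_u], whose norm is at most 1. *)
Lemma perfect_transfer_eproj (u v : 'I_n.+1) (c s : R -> R) :
  (forall r, c r ^+ 2 + s r ^+ 2 = 1) ->
  let C := \sum_(r <- rs) E r v u * c r in
  let S := \sum_(r <- rs) E r v u * s r in
  C ^+ 2 + S ^+ 2 = 1 ->
  forall r, r \in rs -> row v (E r) = (C * c r + S * s r) *: row u (E r) /\
    (C * s r - S * c r) *: row u (E r) = 0.
Proof.
move=> cs1 C S CS1.
(* [f r] and [g r] are the real and imaginary parts of [(C - i S)(c r + i s r)], a product of two
   numbers of modulus 1. *)
pose f r := C * c r + S * s r; pose g r := C * s r - S * c r.
have fg1 r : f r ^+ 2 + g r ^+ 2 = 1.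
  transitivity ((C ^+ 2 + S ^+ 2) * (c r ^+ 2 + s r ^+ 2)); first by rewrite /f /g; ring.
  by rewrite CS1 cs1 mulr1.
pose M := \sum_(r <- rs) f r *: E r.
have Msym : M^T = M.
  by rewrite /M linear_sum /=; apply: eq_bigr => r _; rewrite linearZ /= eproj_tr.
have Mvu : M u v = 1.
  have CE : C = \sum_(r <- rs) E r v u * c r by [].
  have SE : S = \sum_(r <- rs) E r v u * s r by [].
  rewrite -Msym mxE -CS1 2!expr2 {2}CE {2}SE !mulr_sumr -big_split /=.
  by rewrite /M summxE; apply: eq_bigr => r _; rewrite mxE /f; ring.
have sumg : \sum_(r <- rs) f r ^+ 2 * E r u u + \sum_(r <- rs) g r ^+ 2 * E r u u = 1.
  rewrite -big_split /=; transitivity ((1%:M : 'M[R]_n.+1) u u); last by rewrite mxE eqxx.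
  by rewrite -rsE summxE; apply: eq_bigr => r _; rewrite -mulrDl fg1 mul1r.
have Mnorm : (row u M *m (row u M)^T) 0 0 = \sum_(r <- rs) f r ^+ 2 * E r u u.
  transitivity ((M *m M) u u).
    rewrite [LHS]mxE [RHS]mxE; apply: eq_bigr => j _.
    by rewrite [row _ _ _ _]mxE [_^T _ _]mxE [row _ _ _ _]mxE -{2}Msym mxE.
  by rewrite /M sum_scale_eproj_sqr summxE; apply: eq_bigr => r _; rewrite mxE.
have g_ge0 : 0 <= \sum_(r <- rs) g r ^+ 2 * E r u u.
  by apply: sumr_ge0 => r _; rewrite mulr_ge0 ?sqr_ge0 ?eproj_diag_ge0.
have w0 : row u M = row v 1%:M.
  apply/eqP; rewrite -subr_eq0; apply/eqP/row_dot_self_eq0.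
  have -> : ((row u M - row v 1%:M) *m (row u M - row v 1%:M)^T) 0 0 =
      (row u M *m (row u M)^T) 0 0 - 1.
    rewrite [LHS]mxE [in RHS]mxE.
    (* As [M u v = 1], the cross terms and [|e_v|^2] contribute [1 - 2], written as a sum over [j]
       to compare entry by entry. *)
    have -> : -1 = \sum_j (j == v)%:R * (1 - 2 * M u j).
      rewrite (bigD1 v) //= eqxx Mvu big1 => [|j /negPf->]; first by rewrite mulr1n; ring.
      by rewrite mul0r.
    rewrite -big_split /=; apply: eq_bigr => j _; rewrite !mxE eq_sym.
    by case: (j == v); rewrite /= ?mulr1n ?mulr0n; ring.
  by rewrite subr_le0 Mnorm -sumg lerDl.
(* The [f] part now has the whole weight 1, so the nonnegative [g] part vanishes. *)
have g0 : \sum_(r <- rs) g r ^+ 2 * E r u u = 0.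
  apply: (addrI (\sum_(r <- rs) f r ^+ 2 * E r u u)).
  by rewrite sumg -Mnorm w0 addr0 tr_row trmx1 -row_mul mul1mx !mxE eqxx.
move=> r rrs; split.
  rewrite -[E r in LHS]mul1mx row_mul -w0 -row_mul sum_scale_eproj //.
  by apply/rowP => j; rewrite !mxE.
have /eqP := g0; rewrite psumr_eq0; last first.
  by move=> t _; rewrite mulr_ge0 ?sqr_ge0 ?eproj_diag_ge0.
move=> /allP/(_ r rrs) /=; rewrite mulf_eq0 sqrf_eq0 => /orP[/eqP g0r|].
  by rewrite -/(g r) g0r scale0r.
move=> /eqP Euu; suff -> : row u (E r) = 0 by rewrite scaler0.
by apply: row_dot_self_eq0; rewrite eproj_normE Euu.
Qed.
End Transfer.

(** * Alternating signs and 2-adic valuations *)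

Section Alternation.
Variable R : realType.

Lemma sum_moments_poly (s : seq R) (m : R -> R) d (p : {poly R}) :
  (forall k, (k < d)%N -> \sum_(z <- s) z ^+ k * m z = 0) -> (size p <= d)%N ->
  \sum_(z <- s) p.[z] * m z = 0.
Proof.
move=> m0 szp; under eq_bigr => z _ do rewrite (horner_coef_wide _ szp) mulr_suml.
rewrite exchange_big big1 //= => i _.
under eq_bigr => z _ do rewrite -mulrA.
by rewrite -mulr_sumr m0 ?mulr0.
Qed.

(* Apply the orthogonality to the polynomial whose roots are all the nodes but two
   consecutive ones: it takes values of the same sign at these two. *)
Lemma consecutive_moment_sign (s : seq R) (m : R -> R) r :
  sorted (fun x y : R => y < x) s ->
  (forall k, (k < (size s).-1)%N -> \sum_(z <- s) z ^+ k * m z = 0) ->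
  (r.+1 < size s)%N -> m (nth 0 s r) * m (nth 0 s r.+1) <= 0.
Proof.
move=> s_sorted m0 rs; set x := nth 0 s r; set y := nth 0 s r.+1.
pose t := take r s ++ drop r.+2 s.
have sE : s = take r s ++ [:: x, y & drop r.+2 s].
  by rewrite -{1}(cat_take_drop r s) (drop_nth 0) ?(drop_nth 0 rs) // ltnW.
have tr : transitive (fun a b : R => b < a) by move=> a b c ba cb; apply: lt_trans cb ba.
have := s_sorted; rewrite {1}sE sorted_pairwise // pairwise_cat /=.
case/and3P => /allrelP lt1 _ /and3P[/andP[yx /allP ltx] /allP lty _].
pose p := \prod_(z <- t) ('X - z%:P).
have p0 z : z \in t -> p.[z] = 0 by move=> zt; apply/rootP; rewrite root_prod_XsubC.
have pxy : 0 < p.[x] * p.[y].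
  rewrite !horner_prod -big_split /= big_seq prodr_gt0 // => z.
  rewrite mem_cat !hornerXsubC => /orP[zt|zt].
    by rewrite nmulr_rgt0 subr_lt0 lt1 // !inE eqxx ?orbT.
  by rewrite mulr_gt0 // subr_gt0 ?ltx ?lty.
have szp : (size p <= (size s).-1)%N.
  rewrite size_prod_XsubC size_cat size_take size_drop (ltn_trans (ltnSn r)) //.
  lia.
have := sum_moments_poly m0 szp; rewrite sE big_cat !big_cons /=.
rewrite big_seq big1 => [|z zt]; last by rewrite p0 ?mul0r // mem_cat zt.
rewrite add0r [X in _ + (_ + X)]big_seq big1 ?addr0 => [e|z zt]; last first.
  by rewrite p0 ?mul0r // mem_cat zt orbT.
rewrite -(pmulr_rle0 _ pxy).
suff -> : p.[x] * p.[y] * (m x * m y) = - (p.[x] * m x) ^+ 2 by rewrite oppr_le0 sqr_ge0.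
have -> : p.[x] * p.[y] * (m x * m y) = (p.[x] * m x) * (p.[y] * m y) by ring.
by move/eqP: e; rewrite addrC addr_eq0 => /eqP ->; ring.
Qed.

(** Dividing by the positive weights leaves a product of two consecutive signs that is at most 0;
    being 1 or -1, the signs are opposite. *)
Lemma alternating_signs (s : seq R) (sg w : R -> R) :
  sorted (fun x y : R => y < x) s ->
  (forall k, (k < (size s).-1)%N -> \sum_(z <- s) z ^+ k * (sg z * w z) = 0) ->
  (forall z, z \in s -> 0 < w z) -> (forall z, z \in s -> sg z ^+ 2 = 1) ->
  forall r, (r < size s)%N -> sg (nth 0 s r) = (-1) ^+ r * sg (nth 0 s 0).
Proof.
move=> s_sorted m0 w_gt0 sg1; elim=> [|r IHr] rs; first by rewrite mul1r.
have := consecutive_moment_sign s_sorted m0 rs.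
set x := nth 0 s r; set y := nth 0 s r.+1.
have xs : x \in s by rewrite mem_nth // ltnW.
have ys : y \in s by rewrite mem_nth.
have -> : sg x * w x * (sg y * w y) = (w x * w y) * (sg x * sg y) by ring.
rewrite pmulr_rle0 ?mulr_gt0 ?w_gt0 // exprS -mulrA -IHr ?(ltnW rs) // -/x mulN1r.
by move: (sg1 x xs) (sg1 y ys) => /eqP; rewrite sqrf_eq1 => /orP[]/eqP-> /eqP;
  rewrite sqrf_eq1 => /orP[]/eqP->; rewrite ?mulrNN ?mulNr ?mulrN ?mul1r ?opprK ?ler10 //.
Qed.
End Alternation.

(** * 2-adic valuations of integers *)

Section Valuation.

Lemma logn2_mul_odd (x y p q : int) : x * p = y * q -> odd `|p| ->
  y != 0 -> q != 0 -> logn 2 `|x| = (logn 2 `|y| + logn 2 `|q|)%N.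
Proof.
move=> e p_odd y0 q0; rewrite -lognM ?absz_gt0 // -abszM -e abszM.
have p0 : (0 < `|p|)%N by case: `|p|%N p_odd.
have x0 : (0 < `|x|)%N.
  rewrite absz_gt0; apply: contra_eq_neq e => ->.
  by rewrite mul0r eq_sym mulf_neq0.
by rewrite lognM // (lognE 2 `|p|) dvdn2 p_odd /= andbF addn0.
Qed.

Lemma logn2_ge_factor (x : int) al : (al <= logn 2 `|x|)%N -> x != 0 ->
  exists2 k, x = 2 ^+ al * k & odd `|k| = (al == logn 2 `|x|).
Proof.
move=> le x0; have x_gt0 : (0 < `|x|)%N by rewrite absz_gt0.
have : (2 ^+ al %| x)%Z by rewrite dvdzE abszX pfactor_dvdn.
case/dvdzP => k xk; exists k; first by rewrite mulrC.
have k0 : k != 0 by apply: contra_neq x0 => k0; rewrite xk k0 mul0r.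
rewrite xk abszM abszX lognM ?expn_gt0 ?absz_gt0 // lognX.
rewrite (_ : logn 2 `|2 : int|%N = 1%N) // muln1.
rewrite -[X in X == _]add0n eqn_add2r eq_sym -leqn0 leqNgt logn_gt0.
by rewrite mem_primes /= absz_gt0 k0 dvdn2 negbK.
Qed.
End Valuation.

(** * Cospectral vertices *)

Section Cospectral.
Variables (R : realType) (n : nat) (A : 'M[R]_n.+1).
Implicit Types x y : 'I_n.+1.
Local Notation M := (char_poly_mx A).

Lemma char_poly_minor x : char_poly (row' x (col' x A)) = (\adj M) x x.
Proof.
rewrite [RHS]mxE /cofactor -signr_odd addnn odd_double mul1r; congr (\det _).
by apply/matrixP => i j; rewrite !mxE (inj_eq lift_inj).
Qed.

(** Up to sign the entry is a minor of order [n] of a matrix with entries of degree at most 1. *)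
Lemma size_char_poly_adj x y : (size ((\adj M) x y) <= n.+1)%N.
Proof.
rewrite mxE /cofactor /determinant size_Msign.
apply: (leq_trans (size_sum _ _ _)); apply/bigmax_leqP => s _.
rewrite size_Msign; apply: (leq_trans (size_prod_leq _ _)).
rewrite leq_subLR card_ord addnS ltnS.
apply: (@leq_trans (\sum_(i < n) 2)); last by rewrite sum_nat_const card_ord muln2 addnn.
apply: leq_sum => i _; rewrite !mxE.
apply: (leq_trans (size_polyD _ _)); rewrite size_polyN geq_max.
rewrite (leq_trans (size_polyC_leq1 _)) // andbT.
by case: (_ == _); rewrite ?mulr1n ?mulr0n ?size_polyX ?size_poly0.
Qed.

(** Factor [X^N - A^N] through [X - A], which is possible since [X] and [A] commute, and multiply by
    the adjugate, using [\adj M *m M = char_poly A]. *)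
Lemma adj_char_poly_exp N x :
  'X^N * (\adj M) x x - (\adj M *m map_mx polyC (A ^+ N)) x x =
  char_poly A * \sum_(i < N) 'X^(N.-1 - i) * ((A ^+ i) x x)%:P.
Proof.
have comX : GRing.comm ('X%:M : 'M[{poly R}]_n.+1) (map_mx polyC A).
  by rewrite /GRing.comm -!mulmxE scalar_mxC.
have XN k : ('X%:M : 'M[{poly R}]_n.+1) ^+ k = ('X^k)%:M by rewrite -rmorphXn.
have AN k : (map_mx polyC A) ^+ k = map_mx polyC (A ^+ k) by rewrite -rmorphXn.
have := subrXX_comm N comX; rewrite XN AN -mulmxE -/(char_poly_mx A).
move/(congr1 (mulmx (\adj M))); rewrite mulmxA mul_adj_mx mulmxBr mul_mx_scalar mul_scalar_mx.
move=> e; transitivity (('X^N *: \adj M - \adj M *m map_mx polyC (A ^+ N)) x x).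
  by rewrite [RHS]mxE [X in _ = X + _]mxE [X in _ = _ + X]mxE.
rewrite e [LHS]mxE summxE; congr (_ * _).
by apply: eq_bigr => i _; rewrite XN AN mul_scalar_mx !mxE.
Qed.

(* In [adj (X - A) (X^N - A^N) = char_poly A * \sum_i X^(N-1-i) A^i], the difference of the
   diagonal entries at [x] and [y] is settled by comparing degrees. *)
Lemma cospectral_minorP x y :
  char_poly (row' x (col' x A)) = char_poly (row' y (col' y A)) <->
  forall k, (A ^+ k) x x = (A ^+ k) y y.
Proof.
rewrite !char_poly_minor.
pose s N := (\adj M *m map_mx polyC (A ^+ N)) x x - (\adj M *m map_mx polyC (A ^+ N)) y y.
have size_entry N z : (size ((\adj M *m map_mx polyC (A ^+ N)) z z) <= n.+1)%N.
  rewrite mxE; apply: (leq_trans (size_sum _ _ _)); apply/bigmax_leqP => j _.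
  rewrite [X in _ * X]mxE mulrC mul_polyC.
  exact: leq_trans (size_scale_leq _ _) (size_char_poly_adj _ _).
have size_s N : (size (s N) <= n.+1)%N.
  by apply: (leq_trans (size_polyD _ _)); rewrite size_polyN geq_max !size_entry.
have sE N : 'X^N * ((\adj M) x x - (\adj M) y y) = s N +
    char_poly A * \sum_(i < N) 'X^(N.-1 - i) * ((A ^+ i) x x - (A ^+ i) y y)%:P.
  under eq_bigr => i _ do rewrite polyCB mulrBr.
  rewrite sumrB !mulrBr -!adj_char_poly_exp /s; ring.
split=> [adjE k|expE]; last first.
  have := sE n.+1; rewrite big1 ?mulr0 ?addr0 => [e|i _]; last first.
    by rewrite expE subrr polyC0 mulr0.
  apply/eqP; rewrite -subr_eq0; apply/negPn/negP => nz.
  have := size_s n.+1; rewrite -e mulrC size_mulXn //.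
  by rewrite -[X in (_ <= X)%N]addn0 leq_add2l leqn0 size_poly_eq0 (negPf nz).
have := sE k.+1; rewrite adjE subrr mulr0 => /esym e.
set q := \sum_(i < _) _ in e.
(* [char_poly A] is monic of degree [n + 1], above the degree of [s k.+1], so its cofactor
   vanishes. *)
have q0 : q = 0.
  apply/eqP/negPn/negP => nz; have := size_s k.+1.
  rewrite -size_polyN; move/eqP: e; rewrite addr_eq0 => /eqP ->.
  rewrite opprK size_monicM ?char_poly_monic // size_char_poly.
  by move: nz; rewrite -size_poly_gt0; move: (size _) => m; lia.
(* At 0 only the summand [i = k] of [q] survives; the others carry a positive power of [X]. *)
have := congr1 (horner^~ 0) q0; rewrite /q big_ord_recr /= subnn horner0.
rewrite hornerD horner_sum big1 => [|i _]; last first.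
  by rewrite hornerM hornerXn expr0n subn_eq0 leqNgt ltn_ord mul0r.
by rewrite add0r expr0 mul1r hornerC => /eqP; rewrite subr_eq0 => /eqP.
Qed.
End Cospectral.

(** * Perron vectors *)

Section Rayleigh.
Variables (R : realType) (n : nat) (A : 'M[R]_n.+1) (rs : seq R) (rho : R).
Hypothesis Asym : A^T = A.
Local Notation E := (eproj A).
Hypotheses (rs_uniq : uniq rs) (rsE : \sum_(r <- rs) E r = 1%:M).
Hypothesis rho_max : forall r, r \in rs -> E r != 0 -> r <= rho.

Lemma eigenvalue_le_max theta : eigenvalue A theta -> theta <= rho.
Proof.
case/eigenvalueP => w wA w0; rewrite leNgt; apply: contraNN w0 => theta_gt.
rewrite -[w]mulmx1 -rsE mulmx_sumr big_seq big1 // => r rrs.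
rewrite -(eproj_fix wA) -mulmxA; have [re|ne] := eqVneq r theta; last first.
  by rewrite eproj_ortho ?mulmx0 // eq_sym.
have [->|nz] := eqVneq (E r) 0; first by rewrite !mulmx0.
by have := rho_max rrs nz; rewrite leNgt re theta_gt.
Qed.

(** The difference of the two sides is the sum of [(rho - r) |w E_r|^2], with nonnegative terms, so
    [w E_r = 0] for every [r] other than [rho]. *)
Lemma rayleigh_eq_eigen (w : 'rV[R]_n.+1) :
  rho * (w *m w^T) 0 0 <= (w *m A *m w^T) 0 0 -> w *m A = rho *: w.
Proof.
have normE r : (w *m E r *m w^T) 0 0 = ((w *m E r) *m (w *m E r)^T) 0 0.
  by rewrite trmx_mul eproj_tr -[in RHS](mulmxA w) (mulmxA (E r)) eproj_idem mulmxA.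
have norm_ge0 r : 0 <= (w *m E r *m w^T) 0 0.
  by rewrite normE mxE sumr_ge0 // => i _; rewrite [X in _ * X]mxE -expr2 sqr_ge0.
have -> : (w *m w^T) 0 0 = \sum_(r <- rs) (w *m E r *m w^T) 0 0.
  by rewrite -{1}[w]mulmx1 -rsE mulmx_sumr mulmx_suml summxE.
have -> : (w *m A *m w^T) 0 0 = \sum_(r <- rs) r * (w *m E r *m w^T) 0 0.
  rewrite -{1}[A]mulmx1 -rsE !mulmx_sumr mulmx_suml summxE; apply: eq_bigr => r _.
  by rewrite eproj_mul // -scalemxAr -scalemxAl mxE.
rewrite -subr_le0 mulr_sumr -sumrB => le0.
have term_ge0 r : r \in rs ->
    0 <= rho * (w *m E r *m w^T) 0 0 - r * (w *m E r *m w^T) 0 0.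
  move=> rrs; rewrite -mulrBl; have [->|nz] := eqVneq (E r) 0.
    by rewrite mulmx0 mul0mx mxE mulr0.
  by rewrite mulr_ge0 // subr_ge0 rho_max.
have wE0 r : r \in rs -> r != rho -> w *m E r = 0.
  move=> rrs ne; apply: row_dot_self_eq0; rewrite -normE.
  have : rho * (w *m E r *m w^T) 0 0 - r * (w *m E r *m w^T) 0 0 <= 0.
    apply: le_trans le0; rewrite [leRHS](bigD1_seq r) //= lerDl.
    by rewrite big_seq_cond sumr_ge0 // => t /andP[trs _]; exact: term_ge0.
  have [E0|nz] := eqVneq (E r) 0; first by rewrite E0 mulmx0 mul0mx mxE.
  by rewrite -mulrBl pmulr_rle0 // subr_gt0 lt_neqAle ne rho_max.
rewrite -[w]mulmx1 -rsE mulmx_sumr mulmx_suml scaler_sumr big_seq [RHS]big_seq.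
apply: eq_bigr => r rrs; rewrite -mulmxA mul_eproj -scalemxAr.
by have [->//|ne] := eqVneq r rho; rewrite wE0 ?scaler0.
Qed.
End Rayleigh.

Section Perron.
Variables (R : realType) (n : nat) (adj : rel 'I_n.+1).
Hypotheses (adj_sym : symmetric adj) (adj_conn : connected_graph adj).
Local Notation A := (adjmx R adj).
Local Notation E := (eproj A).
Let Asym : A^T = A := adjmx_tr R adj_sym.

(** At a zero entry the eigenvalue equation makes a sum of nonnegative entries over the neighbours
    vanish; zeros thus spread along paths to the whole graph. *)
Lemma nonneg_eigen_gt0 (rho : R) (w : 'rV[R]_n.+1) : w *m A = rho *: w ->
  (forall i, 0 <= w 0 i) -> w != 0 -> forall i, 0 < w 0 i.
Proof.
move=> wA w_ge0 w0 i; rewrite lt_neqAle w_ge0 andbT eq_sym.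
apply: contra w0 => /eqP wi0; apply/eqP/rowP => j; rewrite [RHS]mxE.
have /connectP[p pP ->] := adj_conn i j.
elim: p i wi0 pP => //= k p IHp i wi0 /andP[ik kp]; apply: IHp kp.
have /eqP : (w *m A) 0 i = 0 by rewrite wA mxE wi0 mulr0.
rewrite mxE psumr_eq0; last by move=> t _; rewrite mulr_ge0 // mxE.
by move=> /allP/(_ k); rewrite mem_index_enum mxE adj_sym ik mulr1 => /(_ isT)/eqP.
Qed.

(* For the largest eigenvalue, entrywise absolute values of eigenvectors are eigenvectors
   by the Rayleigh quotient, and nonzero nonnegative eigenvectors are positive. *)
Lemma perron_vec_eproj u : exists rho, perron_vec A (E rho *m evec R u).
Proof.
have [rs rs_uniq rsE] := eproj_sum_eq1 Asym.
have [r0 r0rs] : exists2 r, r \in rs & E r != 0.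
  apply/hasP/negPn/negP => /hasPn h.
  have := rsE; rewrite big_seq big1 => [|r /h/negPn/eqP //].
  by move/eqP; rewrite eq_sym oner_eq0.
move=> Er0.
(* The default [r0] has a nonzero projection itself, so the maximum is attained at such an
   eigenvalue. *)
pose rho := \big[Order.max/r0]_(r <- rs | E r != 0) r.
have rho_max r : r \in rs -> E r != 0 -> r <= rho.
  by move=> rrs nz; apply: le_bigmax_seq.
have rho_nz : E rho != 0.
  apply: (big_ind (fun r => E r != 0)) => // x y ? ?.
  by rewrite /Order.max; case: ifP.
exists rho.
have abs_eigen (z : 'rV[R]_n.+1) : z *m A = rho *: z ->
    map_mx Num.norm z *m A = rho *: map_mx Num.norm z.
  move=> zA; apply: (rayleigh_eq_eigen Asym rs_uniq rsE rho_max).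
  have -> : (map_mx Num.norm z *m (map_mx Num.norm z)^T) 0 0 = (z *m z^T) 0 0.
    by rewrite !mxE; apply: eq_bigr => i _; rewrite !mxE -!expr2 real_normK ?num_real.
  have -> : rho * (z *m z^T) 0 0 = (z *m A *m z^T) 0 0.
    by rewrite zA -scalemxAl [RHS]mxE.
  rewrite ![(_ *m _) 0 0]mxE; apply: ler_sum => i _; rewrite ![_^T _ _]mxE !mxE.
  apply: (le_trans (ler_norm _)); rewrite normrM ler_wpM2r //.
  apply: (le_trans (ler_norm_sum _ _ _)); apply: ler_sum => j _.
  by rewrite normrM !mxE [`|_%:R|]ger0_norm.
have [j zj] : exists j, row j (E rho) != 0.
  apply/existsP; apply: contraNT rho_nz => /existsPn h.
  by apply/eqP/row_matrixP => i; rewrite row0; apply/eqP/negPn/h.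
have row_eigen i : row i (E rho) *m A = rho *: row i (E rho).
  by rewrite -row_mul mul_eproj linearZ.
have abs_ge0 (z : 'rV[R]_n.+1) i : 0 <= map_mx Num.norm z 0 i by rewrite mxE.
have abs_eq0 (z : 'rV[R]_n.+1) : (map_mx Num.norm z == 0) = (z == 0).
  apply/eqP/eqP => [/rowP h|->]; last by apply/rowP => i; rewrite !mxE normr0.
  by apply/rowP => i; have /eqP := h i; rewrite !mxE normr_eq0 => /eqP.
pose w := map_mx Num.norm (row j (E rho)).
have w_gt0 : forall i, 0 < w 0 i.
  by apply: (nonneg_eigen_gt0 (abs_eigen _ (row_eigen j))); rewrite ?abs_eq0.
pose x := row u (E rho).
(* Otherwise the positive vector [w = w E_rho] would vanish at [u]. *)
have x0 : x != 0.
  apply: contra_eq_neq (eproj_fix (abs_eigen _ (row_eigen j))) => x0.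
  apply/eqP => /rowP/(_ u); rewrite -/w.
  have -> : (w *m E rho) 0 u = (x *m w^T) 0 0.
    by rewrite -[in LHS](eproj_tr A rho) !mxE; apply: eq_bigr => i _; rewrite !mxE mulrC.
  by rewrite x0 mul0mx mxE => /esym/eqP; rewrite gt_eqF.
have yE i : (x + map_mx Num.norm x) 0 i = E rho u i + `|E rho u i|.
  by rewrite mxE [X in _ + X]mxE [x 0 i]mxE.
(* [x + |x|] is a nonnegative eigenvector whose entry at [u] is [2 E_rho u u > 0]; its positivity
   everywhere forces that of [x]. *)
have y_gt0 : forall i, 0 < (x + map_mx Num.norm x) 0 i.
  apply: (@nonneg_eigen_gt0 rho).
  - by rewrite mulmxDl scalerDr abs_eigen ?row_eigen.
  - by move=> i; rewrite yE -lerBlDl sub0r -normrN ler_norm.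
  - apply/eqP => /rowP/(_ u)/eqP; rewrite yE [X in _ == X]mxE gt_eqF // ltr_wpDr //.
    exact: eproj_diag_gt0.
split=> [i|].
  have := y_gt0 i; rewrite yE -colE [col _ _ _ _]mxE.
  rewrite -[in 0 < E rho i u](eproj_tr A rho) [_^T _ _]mxE.
  by have [|xi_lt0] := ger0P (E rho u i); rewrite ?subrr ?ltxx //; lra.
exists rho; split.
- by rewrite mulmxA eproj_mul // scalemxAl.
- by apply/eigenvalueP; exists x => //; apply: row_eigen.
- exact: (eigenvalue_le_max Asym rsE rho_max).
Qed.
End Perron.

(** * Walk modules and antipodal vertices *)

Section Krylov.
Variables (R : realType) (n : nat) (A : 'M[R]_n.+1).
Hypothesis Asym : A^T = A.
Local Notation E := (eproj A).

Definition krylov (x : 'I_n.+1) (i : nat) : 'M[R]_(i.+1, n.+1) :=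
  \matrix_(k < i.+1) row x (A ^+ k).

(** A dependency between the rows is a polynomial of degree at most [i]; multiplying by each [E r]
    shows that it vanishes on [s], which has more than [i] elements. *)
Lemma krylov_row_free x i (s : seq R) : uniq s ->
  (forall r, r \in s -> row x (E r) != 0) -> (i < size s)%N -> row_free (krylov x i).
Proof.
move=> s_uniq sE lt; apply: inj_row_free => c; rewrite mulmx_sum_row => cK.
pose p := rVpoly c.
have p_root : all (root p) s.
  apply/allP => r rs; have := congr1 (mulmx^~ (E r)) cK; rewrite mul0mx mulmx_suml.
  under eq_bigr => k _ do
     rewrite rowK -scalemxAl -row_mul exp_mul_eproj // linearZ scalerA.
  rewrite -scaler_suml => /eqP; rewrite scaler_eq0 (negPf (sE r rs)) orbF => /eqP h.
  apply/rootP; rewrite (@horner_coef_wide _ i.+1) ?size_poly // -[RHS]h.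
  by apply: eq_bigr => k _; rewrite coef_rVpoly_ord.
have p0 : p = 0.
  apply: (roots_geq_poly_eq0 p_root s_uniq).
  exact: leq_trans (size_poly _ _) lt.
by rewrite -[c]rVpolyK -/p p0 linear0.
Qed.
End Krylov.

Section Support.
Variables (R : realType) (n : nat) (A : 'M[R]_n.+1) (u : 'I_n.+1) (Phi : seq R).
Hypothesis Asym : A^T = A.
Local Notation E := (eproj A).
Hypothesis Phi_uniq : uniq Phi.
Hypothesis PhiP : forall theta, (theta \in Phi) = (row u (E theta) != 0).

Lemma support_sub (rs : seq R) : \sum_(r <- rs) E r = 1%:M -> {subset Phi <= rs}.
Proof.
move=> rsE theta; rewrite PhiP; apply: contraNT => theta_rs.
by rewrite (eproj_notin Asym rsE theta_rs) row0.
Qed.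

Lemma sum_support (rs : seq R) (V : zmodType) (g : R -> V) : uniq rs ->
  \sum_(r <- rs) E r = 1%:M -> (forall theta, row u (E theta) = 0 -> g theta = 0) ->
  \sum_(r <- rs) g r = \sum_(r <- Phi) g r.
Proof.
move=> rs_uniq rsE g0; rewrite (bigID (fun r => r \in Phi)) /=.
rewrite [X in _ + X]big1 ?addr0 => [|r]; last first.
  by rewrite PhiP negbK => /eqP/g0.
rewrite -big_filter; apply: perm_big; apply: uniq_perm; rewrite ?filter_uniq //.
move=> r; rewrite mem_filter andb_idr //; exact: support_sub.
Qed.

Lemma support_neq0 : (0 < size Phi)%N.
Proof.
have [rs rs_uniq rsE] := eproj_sum_eq1 Asym.
rewrite lt0n size_eq0; apply/eqP => Phi0.
have := @sum_support rs _ (fun r => row u (E r)) rs_uniq rsE (fun _ => id).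
rewrite Phi0 big_nil -linear_sum rsE => /rowP/(_ u)/eqP.
by rewrite !mxE eqxx oner_eq0.
Qed.
End Support.

Section EprojDiagonal.
Variables (R : realType) (n : nat) (A : 'M[R]_n.+1).
Hypothesis Asym : A^T = A.
Local Notation E := (eproj A).

(** All moments of the differences [m r] vanish; the polynomial whose roots are the other nodes
    isolates [m theta]. *)
Lemma eproj_diag_eq u v : (forall k, (A ^+ k) u u = (A ^+ k) v v) ->
  forall theta, E theta u u = E theta v v.
Proof.
move=> expE theta; have [rs rs_uniq rsE] := eproj_sum_eq1 Asym.
have [th|th] := boolP (theta \in rs); last first.
  by rewrite (eproj_notin Asym rsE th) !mxE.
pose m r := E r u u - E r v v; apply/eqP; rewrite -subr_eq0 -/(m theta).
pose p := \prod_(z <- rem theta rs) ('X - z%:P).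
have m0 k : (k < size p)%N -> \sum_(z <- rs) z ^+ k * m z = 0.
  move=> _; transitivity ((A ^+ k) u u - (A ^+ k) v v); last by rewrite expE subrr.
  rewrite (expmx_decomp Asym k rsE) !summxE -sumrB; apply: eq_bigr => r _.
  by rewrite mulrBr [X in _ = X - _]mxE [X in _ = _ - X]mxE.
have := sum_moments_poly m0 (leqnn _); rewrite (bigD1_seq theta) //=.
rewrite big_seq_cond big1 ?addr0 => [/eqP|z /andP[zrs zth]]; last first.
  have /rootP -> : root p z by rewrite /p root_prod_XsubC mem_rem_uniq // inE zth.
  by rewrite mul0r.
rewrite mulf_eq0 => /orP[|//].
by rewrite -/(root p theta) /p root_prod_XsubC mem_rem_uniqF.
Qed.
End EprojDiagonal.

Section Antipodal.
Variables (R : realType) (n : nat) (adj : rel 'I_n.+1) (u v : 'I_n.+1).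
Variables (Phi : seq R) (d : nat).
Hypotheses (adj_sym : symmetric adj) (adj_conn : connected_graph adj).
Local Notation A := (adjmx R adj).
Local Notation E := (eproj A).
Let Asym : A^T = A := adjmx_tr R adj_sym.
Hypothesis Phi_uniq : uniq Phi.
Hypothesis PhiP : forall theta, (theta \in Phi) = (row u (E theta) != 0).
Hypothesis Phi_size : size Phi = d.+1.
Hypothesis ecc_u : ecc adj u = d.
Hypothesis dist_uv : gdist adj u v = d.

(** Row [x] of [A ^+ k] is supported in the ball of radius [k] around [x]. *)
Lemma sub_krylov_eq0 x i (w : 'rV[R]_n.+1) z :
  (w <= krylov A x i)%MS -> (i < gdist adj x z)%N -> w 0 z = 0.
Proof.
case/submxP => c -> lt; rewrite mxE big1 // => k _.
by rewrite !mxE exp_eq0_gdist ?mulr0 // (leq_ltn_trans _ lt) // -ltnS.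
Qed.

Lemma conj_diag_entry (B : 'M[R]_n.+1) (phi : 'cV[R]_n.+1) x z :
  (forall i, 0 < phi i 0) ->
  (invmx (diag_mx phi^T) *m B *m diag_mx phi^T) x z = B x z * phi z 0 / phi x 0.
Proof.
move=> phi_gt0; pose psi : 'rV[R]_n.+1 := \row_i (phi i 0)^-1.
have psiK : diag_mx psi *m diag_mx phi^T = 1%:M.
  rewrite mulmx_diag -diag_const_mx; congr diag_mx; apply/rowP => i.
  by rewrite !mxE mulVf // gt_eqF.
have -> : invmx (diag_mx phi^T) = diag_mx psi.
  have [unit_psi unit_phi] := mulmx1_unit psiK.
  by rewrite -[LHS]mul1mx -psiK mulmxK.
by rewrite mul_mx_diag mul_diag_mx !mxE -mulrA [LHS]mulrC.
Qed.

(** * From signs on the projections to antipodality *)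

Section FromSigns.
Variable sg : R -> R.
Hypothesis row_vE : forall theta, row v (E theta) = sg theta *: row u (E theta).
Hypothesis sg_sqr : forall theta, theta \in Phi -> sg theta ^+ 2 = 1.

Lemma eproj_diag_signs theta : E theta v v = E theta u u.
Proof.
rewrite -!eproj_normE row_vE linearZ /= -scalemxAl -scalemxAr scalerA mxE -expr2.
have [/sg_sqr ->|] := boolP (theta \in Phi); first by rewrite mul1r.
by rewrite PhiP negbK => /eqP ->; rewrite mul0mx mxE mulr0.
Qed.

Lemma cospectral_signs : cospectral R adj u v.
Proof.
apply/cospectral_minorP => k; have [rs rs_uniq rsE] := eproj_sum_eq1 Asym.
rewrite !(expmx_decomp Asym k rsE) !summxE; apply: eq_bigr => r _.
by rewrite [LHS]mxE [RHS]mxE eproj_diag_signs.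
Qed.

(** The row space is the walk module of [u], spanned by projections rather than powers so that its
    stability under [A] is immediate. *)
Let W : 'M[R]_(d.+1, n.+1) := \matrix_(i < d.+1) row u (E (nth 0 Phi i)).

Lemma row_eproj_subW theta : (row u (E theta) <= W)%MS.
Proof.
have [th|] := boolP (theta \in Phi); last first.
  by rewrite PhiP negbK => /eqP ->; rewrite sub0mx.
have lt : (index theta Phi < d.+1)%N by rewrite -Phi_size index_mem.
have -> : row u (E theta) = row (Ordinal lt) W by rewrite rowK nth_index.
exact: row_sub.
Qed.

Lemma krylov_subW x i : x \in [:: u; v] -> (krylov A x i <= W)%MS.
Proof.
move=> x_uv; apply/row_subP => k; rewrite rowK.
have [rs rs_uniq rsE] := eproj_sum_eq1 Asym.
rewrite (expmx_decomp Asym k rsE) linear_sum /=; apply: summx_sub => r _.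
rewrite linearZ /= scalemx_sub //.
move: x_uv; rewrite !inE => /orP[]/eqP->; first exact: row_eproj_subW.
by rewrite row_vE scalemx_sub // row_eproj_subW.
Qed.

Lemma stable_W : (W *m A <= W)%MS.
Proof.
apply/row_subP => i; rewrite row_mul rowK -row_mul mul_eproj linearZ scalemx_sub //.
exact: row_eproj_subW.
Qed.

Lemma row_free_krylov x i : x \in [:: u; v] -> (i <= d)%N -> row_free (krylov A x i).
Proof.
move=> x_uv le_id; apply: (krylov_row_free Asym Phi_uniq); last by rewrite Phi_size ltnS.
move=> r rPhi; have uE : row u (E r) != 0 by rewrite -PhiP.
move: x_uv; rewrite !inE => /orP[]/eqP->; first exact: uE.
rewrite row_vE scaler_eq0 (negPf uE) orbF.
by apply: contra_eq_neq (sg_sqr rPhi) => ->; rewrite expr0n eq_sym oner_eq0.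
Qed.

(* The Krylov spaces of [u] and [v] of dimensions [i + 1] and [d - i + 1] lie in a space
   of dimension [d + 1], hence meet; a common vector is supported where the two balls
   of radii [i] and [d - i] meet. *)
Lemma exists_layer_vector i : (i <= d)%N -> exists w : 'rV[R]_n.+1,
  [/\ w != 0, (w <= W)%MS &
      forall z, w 0 z != 0 -> gdist adj u z = i /\ gdist adj v z = (d - i)%N].
Proof.
move=> le_id; pose P := krylov A u i; pose Q := krylov A v (d - i).
have PW : (P <= W)%MS by rewrite krylov_subW ?mem_head.
have QW : (Q <= W)%MS by rewrite krylov_subW ?inE ?eqxx ?orbT.
have cap0 : (P :&: Q)%MS != 0.
  rewrite -mxrank_eq0 -lt0n -(ltn_add2l (\rank (P + Q)%MS)) addn0 mxrank_sum_cap.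
  have /eqP -> : row_free P by rewrite row_free_krylov ?mem_head.
  have /eqP -> : row_free Q by rewrite row_free_krylov ?inE ?eqxx ?orbT // leq_subr.
  have : (\rank (P + Q)%MS <= d.+1)%N.
    by rewrite (leq_trans _ (rank_leq_row W)) // mxrankS // addsmx_sub PW.
  by move: (\rank _) => m; lia.
exists (nz_row (P :&: Q)%MS); rewrite nz_row_eq0 cap0.
have wP : (nz_row (P :&: Q)%MS <= P)%MS by rewrite (submx_trans (nz_row_sub _)) ?capmxSl.
have wQ : (nz_row (P :&: Q)%MS <= Q)%MS by rewrite (submx_trans (nz_row_sub _)) ?capmxSr.
split=> //; first exact: submx_trans wP PW.
move=> z wz.
have uz : (gdist adj u z <= i)%N.
  by rewrite leqNgt; apply: contra wz => /(sub_krylov_eq0 wP) ->.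
have vz : (gdist adj v z <= d - i)%N.
  by rewrite leqNgt; apply: contra wz => /(sub_krylov_eq0 wQ) ->.
(* The bounds [i] and [d - i] add up to [d(u, v)], so both are attained. *)
have := gdist_triangle R adj_conn z u v.
by rewrite dist_uv (gdistC R adj_sym adj_conn z v); lia.
Qed.

(** The [d + 1] layer vectors have disjoint supports, hence form a basis of the walk module. That
    module contains a Perron vector, which is therefore a multiple of one layer vector on each
    distance class. *)
Lemma antipodal_signs : antipodal R adj u v.
Proof.
have /choice [w wP] : forall i : 'I_d.+1, exists w : 'rV[R]_n.+1,
    [/\ w != 0, (w <= W)%MS &
      forall z, w 0 z != 0 -> gdist adj u z = i /\ gdist adj v z = (d - i)%N].
  by move=> i; apply: exists_layer_vector; rewrite -ltnS.
pose S : 'M[R]_(d.+1, n.+1) := \matrix_i w i.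
have w_supp i j z : w i 0 z != 0 -> j != i -> w j 0 z = 0.
  move=> wiz; apply: contra_neq_eq => wjz; apply: val_inj => /=.
  have [_ _ /(_ z wiz)[<- _]] := wP i.
  by have [_ _ /(_ z wjz)[<- _]] := wP j.
have combE (c : 'rV[R]_d.+1) i z : w i 0 z != 0 -> (c *m S) 0 z = c 0 i * w i 0 z.
  move=> wiz; rewrite mxE (bigD1 i) //= big1 ?addr0 => [|j ji]; first by rewrite mxE.
  by rewrite mxE (w_supp i) ?mulr0.
have S_free : row_free S.
  apply: inj_row_free => c cS; apply/rowP => i; rewrite mxE.
  have [/rV0Pn[z wiz] _ _] := wP i.
  have /eqP := combE c i z wiz; rewrite cS mxE eq_sym mulf_eq0 (negPf wiz) orbF.
  by move/eqP.
have SW : (S <= W)%MS by apply/row_subP => i; rewrite rowK; have [] := wP i.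
have WS : (W <= S)%MS.
  by rewrite -(mxrank_leqif_sup SW) eqn_leq mxrankS //= (eqP S_free) rank_leq_row.
have [rho perron] := perron_vec_eproj R adj_sym adj_conn u.
set phi := E rho *m evec R u in perron.
have phiE z : phi z 0 = row u (E rho) 0 z.
  by rewrite /phi -colE -{1}(eproj_tr A rho) -tr_row mxE.
have phi_gt0 z : 0 < phi z 0 by case: perron => + _; apply.
have [t tE] : exists t, row u (E rho) = t *m S.
  by apply/submxP/(submx_trans _ WS)/row_eproj_subW.
have phi_supp z : exists2 i, w i 0 z != 0 & phi z 0 = t 0 i * w i 0 z.
  have [i wiz] : exists i, w i 0 z != 0.
    apply/existsP; apply: contraTT (phi_gt0 z) => /existsPn w0.
    rewrite phiE tE mxE big1 ?ltxx // => i _.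
    by have := w0 i; rewrite negbK mxE => /eqP ->; rewrite mulr0.
  by exists i; rewrite // phiE tE (combE _ i).
have dist_le z : (gdist adj u z <= d)%N by rewrite -ecc_u gdist_le_ecc.
(* Every vertex lies in the support of a layer vector, so its two distances add up to [d], and [v]
   has the classes of [u] in reverse order. *)
have dist_vE z : gdist adj v z = (d - gdist adj u z)%N.
  by have [i wiz _] := phi_supp z; have [_ _ /(_ z wiz)[-> ->]] := wP i.
pose ord_dist z : 'I_d.+1 := Ordinal (dist_le z : (gdist adj u z < d.+1)%N).
have w_ord z : w (ord_dist z) 0 z != 0.
  have [i wiz _] := phi_supp z; suff -> : ord_dist z = i by [].
  by have [_ _ /(_ z wiz)[zi _]] := wP i; apply: val_inj.
have w_ord0 (i : 'I_d.+1) z : gdist adj u z != i -> w i 0 z = 0.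
  by move=> ne; apply: (w_supp (ord_dist z)) => //; rewrite eq_sym -val_eqE.
have phi_ord z : phi z 0 = t 0 (ord_dist z) * w (ord_dist z) 0 z.
  by rewrite phiE tE (combE _ (ord_dist z)).
split.
- exists phi; split=> // D M C K /imsetP[c _ ->] /imsetP[x0 _ ->] x y; rewrite !inE => xK yK.
  pose i := ord_dist c.
  have [q qE] : exists q, w i *m A = q *m S.
    apply/submxP; apply: submx_trans WS; apply: submx_trans stable_W.
    by rewrite submxMr //; have [] := wP i.
  (* The Perron vector restricted to the class of [c] is [t_i w_i], and [w_i A] is a combination of
     layer vectors; the factor [w_j z] of the class [j] of [z] cancels. *)
  have sumE z : \sum_(k in [set k | gdist adj u k == gdist adj u c])
      (invmx (diag_mx phi^T) *m A *m diag_mx phi^T) z k =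
      t 0 i * q 0 (ord_dist z) / t 0 (ord_dist z).
    transitivity (t 0 i * (w i *m A) 0 z / phi z 0).
      rewrite mxE mulr_sumr mulr_suml big_mkcond /=; apply: eq_bigr => k _.
      rewrite inE; case: eqP => [kc|/eqP kc]; last first.
        by rewrite w_ord0 // mul0r mulr0 mul0r.
      rewrite conj_diag_entry // phi_ord (_ : ord_dist k = i); last exact: val_inj.
      rewrite -{1}Asym [_^T _ _]mxE; congr (_ / _); ring.
    have tz : t 0 (ord_dist z) != 0.
      by apply: contraTneq (phi_gt0 z) => t0; rewrite phi_ord t0 mul0r ltxx.
    by rewrite qE (combE _ _ _ (w_ord z)) phi_ord; field; rewrite w_ord tz.
  rewrite /M /D !sumE (_ : ord_dist x = ord_dist y) //.
  by apply: val_inj; rewrite /= (eqP xK) (eqP yK).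
- apply/setP => C; apply/imsetP/imsetP => -[x _ ->]; exists x => //;
    apply/setP => z; rewrite !inE !dist_vE; have := dist_le x; have := dist_le z; lia.
- apply/setP => z; rewrite !inE dist_uv; apply/eqP/eqP => [zd|->//].
  by apply/esym/(gdist_eq0 R adj_conn); rewrite dist_vE zd subnn.
- by rewrite dist_uv.
- exact: cospectral_signs.
Qed.
End FromSigns.

(* The span of the restrictions of the Perron vector to the distance classes is
   [A]-invariant, contains [e_u] and has dimension at most [d + 1], so it is the Krylov
   space of [u]; it contains [e_v] because [{v}] is a class. *)
Lemma antipodal_row_krylov : antipodal R adj u v -> (row v 1%:M <= krylov A u d)%MS.
Proof.
case=> -[phi [[phi_gt0 _] pe]] _ last_class _ _.
pose M := invmx (diag_mx phi^T) *m A *m diag_mx phi^T.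
have ME x z : M x z = A x z * phi z 0 / phi x 0 by apply: conj_diag_entry.
pose cls i := [set z | gdist adj u z == i].
pose f i : 'rV[R]_n.+1 := \row_z (if z \in cls i then phi z 0 else 0).
pose F : 'M[R]_(d.+1, n.+1) := \matrix_(i < d.+1) f i.
have fF i : (i <= d)%N -> (f i <= F)%MS.
  rewrite -ltnS => lt; have -> : f i = row (Ordinal lt) F by rewrite rowK.
  exact: row_sub.
have dist_le z : (gdist adj u z <= d)%N by rewrite -ecc_u gdist_le_ecc.
have cls_dist z : cls (gdist adj u z) \in distpart adj u by apply: imset_f.
have F_stable : (F *m A <= F)%MS.
  apply/row_subP => i; rewrite row_mul rowK.
  have [/existsP[c ci]|/existsPn no_z] := boolP [exists c, c \in cls i]; last first.
    suff -> : f i = 0 by rewrite mul0mx sub0mx.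
    by apply/rowP => z; rewrite !mxE (negPf (no_z z)).
  (* The quotient entry, read off any vertex of class [j]; the default 0 serves only empty classes,
     where [f j = 0]. *)
  pose q (j : nat) := if [pick x in cls j] is Some x then \sum_(z in cls i) M x z else 0.
  suff -> : f i *m A = \sum_(j < d.+1) q j *: f j.
    by apply: summx_sub => j _; rewrite scalemx_sub // fF // -ltnS.
  apply/rowP => x; rewrite summxE.
  have ltx : (gdist adj u x < d.+1)%N by rewrite ltnS.
  rewrite (bigD1 (Ordinal ltx)) //= big1 ?addr0 => [|j jx]; last first.
    by rewrite !mxE inE -val_eqE /= eq_sym in jx *; rewrite (negPf jx) mulr0.
  rewrite !mxE inE eqxx /q; case: pickP => [y|/(_ x)]; last by rewrite inE eqxx.
  move=> yx; have -> : \sum_(z in cls i) M y z = \sum_(z in cls i) M x z.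
    apply: (pe (cls i) (cls (gdist adj u x))) => //; last by rewrite inE.
    by move: ci; rewrite inE => /eqP <-.
  rewrite mulr_suml [RHS]big_mkcond /=; apply: eq_bigr => z _.
  rewrite [f i _ _]mxE; case: ifP => zi; last by rewrite mul0r.
  by rewrite ME -{1}Asym [_^T _ _]mxE; field; rewrite gt_eqF.
have uF : (row u 1%:M <= F)%MS.
  have -> : row u 1%:M = (phi u 0)^-1 *: f 0%N; last by rewrite scalemx_sub ?fF.
  apply/rowP => z; rewrite !mxE inE; have [->|uz] := eqVneq u z.
    by rewrite gdistxx // eqxx mulVf // gt_eqF.
  case: eqP => [/(gdist_eq0 R adj_conn) /eqP|]; first by rewrite (negPf uz).
  by rewrite mulr0.
have expF k : (row u (A ^+ k) <= F)%MS.
  elim: k => [|k IHk]; first exact: uF.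
  rewrite exprSr -mulmxE row_mul (submx_trans _ F_stable) //.
  exact: submxMr.
have KF : (krylov A u d <= F)%MS by apply/row_subP => k; rewrite rowK.
have K_free : row_free (krylov A u d).
  apply: (krylov_row_free Asym Phi_uniq); last by rewrite Phi_size.
  by move=> r; rewrite PhiP.
(* [F] has only [d + 1] rows, the dimension of the Krylov space inside its row space. *)
have FK : (F <= krylov A u d)%MS.
  by rewrite -(mxrank_leqif_sup KF) eqn_leq mxrankS //= (eqP K_free) rank_leq_row.
apply: submx_trans FK; have -> : row v 1%:M = (phi v 0)^-1 *: f d.
  apply/rowP => z; rewrite !mxE /cls -dist_uv last_class inE eq_sym.
  by case: eqP => [->|_]; rewrite ?mulVf ?mulr0 // gt_eqF.
by rewrite scalemx_sub ?fF.
Qed.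

(** If [e_v = p(A) e_u], then [sg theta] is [p(theta)]. Cospectrality gives [E_theta e_u] and
    [E_theta e_v] equal norms, so its square is 1 on the support. *)
Lemma antipodal_row_eproj : antipodal R adj u v -> exists2 sg : R -> R,
  forall theta, row v (E theta) = sg theta *: row u (E theta) &
  forall theta, theta \in Phi -> sg theta ^+ 2 = 1.
Proof.
move=> anti; have /submxP[c] := antipodal_row_krylov anti; rewrite mulmx_sum_row => cE.
pose sg theta := \sum_k c 0 k * theta ^+ k.
have row_vE theta : row v (E theta) = sg theta *: row u (E theta).
  rewrite -[in LHS](mul1mx (E theta)) row_mul cE mulmx_suml scaler_suml.
  apply: eq_bigr => k _; rewrite rowK -scalemxAl -row_mul exp_mul_eproj //.
  by rewrite linearZ scalerA.
exists sg => // theta; rewrite PhiP => /(eproj_diag_gt0 (A := A)) Euu.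
case: anti => _ _ _ _ /cospectral_minorP/(eproj_diag_eq Asym)/(_ theta).
rewrite -[RHS]eproj_normE row_vE linearZ /= -scalemxAl -scalemxAr scalerA [RHS]mxE.
rewrite eproj_normE -expr2 => /eqP; rewrite eq_sym -subr_eq0 -{2}[E theta u u]mul1r.
by rewrite -mulrBl mulf_eq0 (gt_eqF Euu) orbF subr_eq0 => /eqP.
Qed.

(** The moment of order [k] is the entry of [A ^+ k] at [v], [u], which is 0 below the distance. *)
Lemma sum_moments_signs (sg : R -> R) k :
  (forall theta, row v (E theta) = sg theta *: row u (E theta)) -> (k < d)%N ->
  \sum_(z <- Phi) z ^+ k * (sg z * E z u u) = 0.
Proof.
move=> row_vE lt; have [rs rs_uniq rsE] := eproj_sum_eq1 Asym.
rewrite -(sum_support Asym Phi_uniq PhiP (g := fun z => z ^+ k * (sg z * E z u u)) rs_uniq rsE).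
  transitivity ((A ^+ k) v u); last first.
    by rewrite exp_eq0_gdist // (gdistC R adj_sym adj_conn) dist_uv.
  rewrite (expmx_decomp Asym k rsE) summxE; apply: eq_bigr => r _.
  rewrite [RHS]mxE; congr (_ * _).
  transitivity (row v (E r) 0 u); last by rewrite [LHS]mxE.
  by rewrite row_vE [RHS]mxE [row _ _ _ _]mxE.
by move=> theta uE0; rewrite -eproj_normE uE0 mul0mx mxE !mulr0.
Qed.
End Antipodal.

(** * Perfect state transfer *)

Section StateTransfer.
Variables (R : realType) (n : nat) (adj : rel 'I_n.+1) (u v : 'I_n.+1).
Variables (Phi : seq R) (d : nat).
Hypotheses (adj_sym : symmetric adj) (adj_conn : connected_graph adj).
Local Notation A := (adjmx R adj).
Local Notation E := (eproj A).
Let Asym : A^T = A := adjmx_tr R adj_sym.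
Hypothesis Phi_sorted : sorted (fun x y : R => y < x) Phi.
Hypothesis PhiP : forall theta, (theta \in Phi) = (row u (E theta) != 0).
Hypothesis Phi_size : size Phi = d.+1.
Hypothesis dist_uv : gdist adj u v = d.
Local Notation theta_ r := (nth 0 Phi r).

Lemma decreasing_uniq : uniq Phi.
Proof.
apply: sorted_uniq Phi_sorted => [x y z xy yz|x]; last exact: ltxx.
exact: lt_trans yz xy.
Qed.

Lemma decreasing_nth_lt r : (0 < r)%N -> (r < size Phi)%N -> theta_ r < theta_ 0%N.
Proof.
move=> r0 rs; have tr : transitive (fun x y : R => y < x).
  by move=> x y z xy yz; apply: lt_trans yz xy.
by apply: (sorted_ltn_nth tr 0 Phi_sorted) => //; rewrite inE // (ltn_trans r0).
Qed.

(** Alternation applies with weights [|E_z e_u|^2]: the moments vanish below order [d], one less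
    than the number of nodes. *)
Lemma nth_signs (sg : R -> R) r :
  (forall theta, row v (E theta) = sg theta *: row u (E theta)) ->
  (forall theta, theta \in Phi -> sg theta ^+ 2 = 1) -> (r < size Phi)%N ->
  sg (theta_ r) = (-1) ^+ r * sg (theta_ 0%N).
Proof.
move=> row_vE sg_sqr; apply: (alternating_signs Phi_sorted (w := fun z => E z u u)) => //.
  move=> k lt; apply: (sum_moments_signs adj_sym adj_conn decreasing_uniq PhiP dist_uv row_vE).
  by rewrite Phi_size in lt.
by move=> z; rewrite PhiP => /eproj_diag_gt0.
Qed.

Lemma pst_at_signs tau : pst_at adj u v tau -> exists2 sg : R -> R,
  forall theta, row v (E theta) = sg theta *: row u (E theta) &
  forall theta, theta \in Phi -> sg theta ^+ 2 = 1 /\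
    sg theta * sg (theta_ 0%N) = cos (tau * theta_ 0%N - tau * theta).
Proof.
have [rs rs_uniq rsE] := eproj_sum_eq1 Asym.
rewrite /pst_at (expiA_reE Asym rsE) (expiA_imE Asym rsE).
set C := \sum_(r <- rs) _; set S := \sum_(r <- rs) _ => CS1.
have := @perfect_transfer_eproj _ _ _ Asym rs rs_uniq rsE u v
  (fun r => cos (tau * r)) (fun r => sin (tau * r)) (fun r => cos2Dsin2 _) CS1.
rewrite -/C -/S => transfer.
pose f r := C * cos (tau * r) + S * sin (tau * r).
have f0 r : r \in Phi -> C * sin (tau * r) - S * cos (tau * r) = 0.
  move=> rPhi; have [_ /eqP] := transfer r (support_sub Asym PhiP rsE rPhi).
  by rewrite scaler_eq0 -[X in _ || X]negbK -PhiP rPhi orbF => /eqP.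
(* On the support [(C - i S) exp(i tau r)] is real and equals [f r], so [f r * f s] is the real part
   of [exp(i tau (s - r))]. *)
have f_mul r s : r \in Phi -> s \in Phi -> f r * f s = cos (tau * s - tau * r).
  move=> rPhi sPhi; rewrite cosB -[RHS]mul1r -CS1 -[LHS]addr0.
  rewrite -[X in _ + X](mul0r (C * sin (tau * s) - S * cos (tau * s))) -(f0 r rPhi) /f; ring.
exists f => [theta|theta th].
  have [/transfer[]//|th] := boolP (theta \in rs).
  by rewrite (eproj_notin Asym rsE th) !row0 scaler0.
rewrite expr2 !f_mul //; first by rewrite subrr cos0.
by rewrite mem_nth // Phi_size.
Qed.

(** The sign of each projection cancels against the sign from its phase, so both sums reduce to
    their value at [theta_0] times the total weight 1 of [e_u]. *)
Lemma signs_pst_at (sg : R -> R) tau :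
  (forall theta, row v (E theta) = sg theta *: row u (E theta)) ->
  (forall theta, theta \in Phi -> sg theta ^+ 2 = 1) ->
  (forall r, (r < size Phi)%N -> exists2 k : int,
     tau * theta_ r = tau * theta_ 0%N + k%:~R * pi & odd `|k| = odd r) ->
  pst_at adj u v tau.
Proof.
move=> row_vE sg_sqr phase; have [rs rs_uniq rsE] := eproj_sum_eq1 Asym.
rewrite /pst_at (expiA_reE Asym rsE) (expiA_imE Asym rsE).
have Evu r : E r v u = sg r * E r u u.
  transitivity (row v (E r) 0 u); first by rewrite [RHS]mxE.
  by rewrite row_vE [LHS]mxE [row _ _ _ _]mxE.
have trace1 : \sum_(r <- rs) E r u u = 1.
  by rewrite -summxE rsE mxE eqxx.
have sumE (g : R -> R) : (forall x k, g (x + k%:~R * pi) = (-1) ^+ odd `|k| * g x) ->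
    \sum_(r <- rs) E r v u * g (tau * r) = sg (theta_ 0%N) * g (tau * theta_ 0%N).
  move=> gD; rewrite -[RHS]mulr1 -trace1 mulr_sumr; apply: eq_bigr => r _; rewrite Evu.
  have [rPhi|] := boolP (r \in Phi); last first.
    by rewrite PhiP negbK -eproj_normE => /eqP ->; rewrite mul0mx mxE !mulr0 mul0r.
  have lt : (index r Phi < size Phi)%N by rewrite index_mem.
  have [k kE k_odd] := phase _ lt; have := nth_signs row_vE sg_sqr lt.
  rewrite nth_index // in kE * => ->; rewrite kE gD k_odd signr_odd.
  set e := (-1) ^+ _; have ee : e * e = 1 by rewrite -expr2 sqrr_sign.
  by rewrite -[RHS]mul1r -ee; ring.
rewrite (sumE _ (@cosDzpi R)) (sumE _ (@sinDzpi R)) !exprMn -mulrDr cos2Dsin2 mulr1.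
by rewrite sg_sqr // mem_nth // Phi_size.
Qed.

(** * Eigenvalues of the form [(a + b_r sqrt Delta) / 2] *)

Section QuadraticIntegers.
Variables (a Delta : int) (b : nat -> int).
Hypothesis Phi_nth : forall r, (r < size Phi)%N ->
  theta_ r = ((a%:~R + (b r)%:~R * Num.sqrt (Delta%:~R)) / 2).
Local Notation sqD := (Num.sqrt (Delta%:~R) : R).

Lemma nth_subE r : (r < size Phi)%N ->
  theta_ 0%N - theta_ r = (b 0%N - b r)%:~R * (sqD / 2).
Proof.
by move=> rs; rewrite (Phi_nth rs) (Phi_nth (leq_ltn_trans (leq0n r) rs)) rmorphB; field.
Qed.

(** Both are factors of a positive eigenvalue gap. As [Num.sqrt] is 0 on negative numbers, this also
    forces [Delta > 0]. *)
Lemma nth_sub_neq0 r : (0 < r)%N -> (r < size Phi)%N -> b 0%N - b r != 0 /\ sqD != 0.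
Proof.
move=> r0 rs; have := decreasing_nth_lt r0 rs; rewrite -subr_gt0 nth_subE // => h.
by split; apply: contraTneq h => ->; rewrite ?mul0r ?mulr0 ltxx.
Qed.

(** Cross-multiplying the phase equations at [r] and 1 eliminates [tau], [pi] and the root:
    [(b_0 - b_r) k1 = (b_0 - b_1) k] with [k1] odd. So [al] is the valuation of [b_0 - b_1], and the
    parity of [k] decides. *)
Lemma phase_valuation tau :
  (forall r, (r < size Phi)%N -> exists2 k : int,
     tau * theta_ 0%N - tau * theta_ r = k%:~R * pi & odd `|k| = odd r) ->
  exists al, forall r, (r < size Phi)%N ->
    (odd r -> logn 2 `|b 0%N - b r|%N = al) /\
    (~~ odd r -> (2 <= r)%N -> (al < logn 2 `|b 0%N - b r|)%N).
Proof.
move=> phase; have [size1|size_gt1] := leqP (size Phi) 1.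
  by exists 0%N => -[|r] rs; first by []; move: (leq_trans rs size1).
exists (logn 2 `|b 0%N - b 1%N|) => r rs.
have [->|r_gt0] := posnP r; first by [].
have [k1 k1E k1_odd] := phase 1%N size_gt1.
have [k kE k_odd] := phase r rs.
have [br0 sqD0] := nth_sub_neq0 r_gt0 rs.
have [b10 _] := nth_sub_neq0 (ltn0Sn 0) size_gt1.
have pi0 : (pi : R) != 0 by rewrite gt_eqF ?pi_gt0.
have e : (b 0%N - b r) * k1 = (b 0%N - b 1%N) * k.
  apply: (mulIf (x := 1)) => //; rewrite !mulr1; apply: (@intr_inj R).
  rewrite !rmorphM /=; apply: (mulIf pi0); rewrite -!mulrA -k1E -kE -!mulrBr !nth_subE //.
  ring.
have k0 : k != 0.
  apply: contra_eq_neq e => ->; rewrite mulr0 mulf_neq0 //.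
  by apply: contraTneq k1_odd => ->.
have -> := logn2_mul_odd e k1_odd b10 k0.
split=> [r_odd|r_even r_gt1].
  by rewrite (lognE 2 `|k|) dvdn2 k_odd r_odd /= andbF addn0.
by rewrite -[ltnLHS]addn0 ltn_add2l logn_gt0 mem_primes /= absz_gt0 k0 dvdn2 k_odd.
Qed.

(** With [b_0 - b_r = 2^al m], the phase [tau (theta_0 - theta_r)] is [k m pi], and [m] is odd
    exactly when [r] is. *)
Lemma valuation_phase al (k : int) : odd `|k| ->
  (forall r, (r < size Phi)%N -> odd r -> logn 2 `|b 0%N - b r|%N = al) ->
  (forall r, (r < size Phi)%N -> ~~ odd r -> (2 <= r)%N ->
     (al < logn 2 `|b 0%N - b r|)%N) ->
  let tau := k%:~R * (2 * pi / (2 ^+ al * sqD)) in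
  forall r, (r < size Phi)%N -> exists2 m : int,
     tau * theta_ r = tau * theta_ 0%N + m%:~R * pi & odd `|m| = odd r.
Proof.
move=> k_odd cond2 cond3 tau r rs.
(* [r = 0] is treated apart: with a single eigenvalue in the support [sqD] may be 0. *)
have [->|r_gt0] := posnP r; first by exists 0; rewrite ?mul0r ?addr0.
have [br0 sqD0] := nth_sub_neq0 r_gt0 rs.
have [le_al eq_al] : (al <= logn 2 `|b 0%N - b r|)%N /\
    (al == logn 2 `|b 0%N - b r|) = odd r.
  have [r_odd|r_even] := boolP (odd r); first by rewrite cond2 // eqxx leqnn.
  have lt : (al < logn 2 `|b 0%N - b r|)%N.
    by apply: cond3 => //; move: r_gt0 r_even; case: (r) => [|[|]].
  by rewrite ltnW // ltn_eqF.
have [m mE m_odd] := logn2_ge_factor le_al br0.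
exists (- (k * m)); last by rewrite abszN abszM oddM k_odd m_odd.
have -> : theta_ r = theta_ 0%N - (b 0%N - b r)%:~R * (sqD / 2) by rewrite -nth_subE // subKr.
rewrite mE /tau rmorphN !rmorphM rmorphXn /=; field.
by rewrite sqD0 expf_neq0.
Qed.
End QuadraticIntegers.
End StateTransfer.

Theorem theorem4p1 (R : realType) (n : nat) (adj : rel 'I_n) (u v : 'I_n)
  (Phi : seq R) (a Delta : int) (b : nat -> int) :
  simple_graph adj -> connected_graph adj ->
  (* Phi = Phi_u, listed in strictly decreasing order *)
  sorted (fun x y : R => y < x) Phi ->
  (forall theta : R, theta \in Phi = (eproj (adjmx R adj) theta *m evec R u != 0)) ->
  (* u spectrally extremal: eps_u = d*(u) = |Phi_u| - 1 *)
  ecc adj u = (size Phi).-1 ->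
  gdist adj u v = ecc adj u ->
  (forall r, (r < size Phi)%N ->
     nth 0 Phi r = ((a%:~R + (b r)%:~R * Num.sqrt (Delta%:~R)) / 2)) ->
  let cond2 (al : nat) := forall r, (r < size Phi)%N -> odd r ->
                            logn 2 `|b 0%N - b r|%N = al in
  let cond3 (al : nat) := forall r, (r < size Phi)%N -> ~~ odd r -> (2 <= r)%N ->
                            (al < logn 2 `|b 0%N - b r|%N)%N in
  (pst R adj u v <-> antipodal R adj u v /\ exists al : nat, cond2 al /\ cond3 al)
  /\
  (forall al : nat, antipodal R adj u v -> cond2 al -> cond3 al ->
     forall k : int, odd `|k|%N ->
       pst_at (R:=R) adj u v (k%:~R * (2 * pi / (2 ^+ al * Num.sqrt (Delta%:~R))))).
Proof.
case: n adj u v => [|n] adj u v; first by case: u.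
move=> [adj_sym _] adj_conn Phi_sorted PhiP0 ecc_u dist_uv Phi_nth cond2 cond3.
have Asym := adjmx_tr R adj_sym.
have PhiP theta : (theta \in Phi) = (row u (eproj (adjmx R adj) theta) != 0).
  by rewrite PhiP0 row_eproj_evec.
have Phi_uniq := decreasing_uniq Phi_sorted.
(* The support is nonempty, so the truncated predecessor is the true [|Phi_u| - 1]. *)
have Phi_size : size Phi = (size Phi).-1.+1.
  by rewrite prednK // (support_neq0 Asym Phi_uniq PhiP).
rewrite ecc_u in dist_uv.
have timed al : antipodal R adj u v -> cond2 al -> cond3 al ->
    forall k : int, odd `|k|%N ->
    pst_at (R:=R) adj u v (k%:~R * (2 * pi / (2 ^+ al * Num.sqrt (Delta%:~R)))).
  move=> anti c2 c3 k k_odd.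
  have [sg row_vE sg_sqr] :=
    antipodal_row_eproj adj_sym adj_conn Phi_uniq PhiP Phi_size ecc_u dist_uv anti.
  apply: (signs_pst_at adj_sym adj_conn Phi_sorted PhiP Phi_size dist_uv row_vE sg_sqr).
  exact: (valuation_phase Phi_sorted Phi_nth k_odd c2 c3).
split=> //; split=> [[tau tau_pst]|[anti [al [c2 c3]]]]; last first.
  by exists (1%:~R * (2 * pi / (2 ^+ al * Num.sqrt (Delta%:~R)))); apply: timed.
have [sg row_vE sgE] := pst_at_signs adj_sym PhiP Phi_size tau_pst.
have sg_sqr theta : theta \in Phi -> sg theta ^+ 2 = 1 by case/sgE.
split.
  exact: (antipodal_signs adj_sym adj_conn Phi_uniq PhiP Phi_size ecc_u dist_uv row_vE).
have [r rs|al alP] := phase_valuation (tau := tau) Phi_sorted Phi_nth.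
  (* The cosine of the phase difference is [s_r s_0], which equals [(-1)^r] by alternation. *)
  apply: cos_sign_zpi; have [_ <-] := sgE _ (mem_nth 0 rs).
  rewrite (nth_signs adj_sym adj_conn Phi_sorted PhiP Phi_size dist_uv row_vE sg_sqr rs).
  rewrite -mulrA -expr2 sg_sqr ?mulr1 ?signr_odd // mem_nth // Phi_size.
  by [].
by exists al; split=> r rs; case: (alP r rs).
Qed.
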